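(* Let $\mathcal V$ be a complex, separable, reflexive Banach space and $\mathcal H$ a complex, separable Hilbert space with inner product $(\cdot,\cdot)$ and norm $\|\cdot\|$, such that $\mathcal V,\mathcal H,\mathcal V^*$ form a Gelfand triple and the embedding $\mathcal V\hookrightarrow\mathcal H$ is compact. Let $a\colon\mathcal V\times\mathcal V\to\mathbb C$ be a continuous Hermitian sesquilinear form for which there are real constants $\alpha>0$, $\beta\ge 0$ with $a(u,u)\ge\alpha\|u\|_{\mathcal V}^2-\beta\|u\|^2$ for all $u\in\mathcal V$. Let $u^0\in\mathcal V$, $u^0\neq 0$, and define for $j=1,2,\dots$ the iterate $u^j\in\mathcal V$ as the solution of $$\mathcal A_\beta u^j=\mu^{j-1}\,\mathcal I\tilde u^{j-1}\quad\text{in }\mathcal V^*,\qquad \tilde u^{j}:=\frac{u^{j}}{\|u^{j}\|},\qquad \mu^j:=\frac{\langle\mathcal A_\beta u^j,u^j\rangle}{\langle\mathcal I u^j,u^j\rangle},$$ and set $\lambda^j:=\mu^j-\beta$. Then the iteration converges to an eigenpair up to subsequences: there exist an eigenpair $(u^\star,\lambda^\star)$, i.e. $u^\star\in\mathcal V\setminus\{0\}$ and $\lambda^\star\in\mathbb R$ with $\mathcal A u^\star=\lambda^\star\,\mathcal I u^\star$ in $\mathcal V^*$, and a subsequence (not relabeled) along which $u^j\to u^\star$ in $\mathcal V$ and $\lambda^j\to\lambda^\star$.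
   Context: $\mathcal V^*$ is the conjugate dual of $\mathcal V$ (continuous conjugate-linear maps $\mathcal V\to\mathbb C$), with duality pairing $\langle\cdot,\cdot\rangle$. That $\mathcal V,\mathcal H,\mathcal V^*$ form a Gelfand triple means in particular that $\mathcal V\hookrightarrow\mathcal H$ is continuous and dense. Sesquilinear forms are linear in the first and conjugate linear in the second argument; $a$ Hermitian means $a(u,v)=\overline{a(v,u)}$. The operators $\mathcal A,\mathcal I,\mathcal A_\beta\colon\mathcal V\to\mathcal V^*$ are defined by $\langle\mathcal A u,v\rangle:=a(u,v)$, $\langle\mathcal I u,v\rangle:=(u,v)$, and $\mathcal A_\beta:=\mathcal A+\beta\mathcal I$ (which is invertible by the Gårding inequality). *)

(* Defs.v *)
From HB Require Import structures.
From mathcomp Require Import all_boot all_order all_algebra.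
From mathcomp Require Import sesquilinear complex.
From mathcomp Require Import all_classical all_reals all_analysis.

Set Implicit Arguments.
Unset Strict Implicit.
Unset Printing Implicit Defensive.

Import Order.TTheory GRing.Theory Num.Theory.
Import numFieldNormedType.Exports.

Local Open Scope classical_set_scope.
Local Open Scope ring_scope.
Local Open Scope complex_scope.

(* The topology of the scalar field lives on the regular module R[i]^o, since
   R[i] itself carries the structure of an R-module. *)

Definition separable (T : topologicalType) : Prop :=
  exists2 D : set T, countable D & dense D.

Section ConjugateDual.
Variables (R : realType) (V : normedModType R[i]).

Definition cdual_pred : {pred V -> R[i]^o} :=
  fun f => `[< linear_for (Num.conj \; *%R) f /\ continuous f >].

Lemma cdual_submod_closed : submod_closed cdual_pred.
Proof.
split=> [|c f g /asboolP[fL fC] /asboolP[gL gC]]; apply/asboolP; split.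
- by move=> k u v; rewrite /= mulr0 addr0.
- exact: cst_continuous.
- by move=> k u v; rewrite !fctE fL gL /= /GRing.scale/= !mulrDr mulrCA addrACA.
- move=> x; apply: cvgD; last exact: gC.
  by apply: cvgZr; exact: fC.
Qed.

HB.instance Definition _ :=
  GRing.isSubmodClosed.Build R[i] (V -> R[i]^o) cdual_pred cdual_submod_closed.

(* V^* : the continuous conjugate-linear functionals on V. *)
Record cdual := CDual { cdual_fun :> V -> R[i]^o; _ : cdual_fun \in cdual_pred }.

HB.instance Definition _ := [isSub for cdual_fun].
HB.instance Definition _ := [Choice of cdual by <:].
HB.instance Definition _ := [SubChoice_isSubLmodule of cdual by <:].

Definition dual_norm (f : cdual) : R :=
  sup [set complex.Re `|f v| | v in [set v : V | `|v| <= 1]].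

(* The canonical map of V into its bidual, v |-> (f |-> conj (f v)), is onto;
   the bidual is the conjugate dual of V^* for the operator norm. *)
Definition reflexive_space : Prop :=
  forall Phi : cdual -> R[i],
    linear_for (Num.conj \; *%R) Phi ->
    (exists M : R, forall f : cdual, `|Phi f| <= (M * dual_norm f)%:C) ->
    exists v : V, forall f : cdual, Phi f = Num.conj (f v).

End ConjugateDual.

Section HilbertInner.
Variables (R : realType) (H : normedModType R[i]) (ip : {dot H for Num.conj}).

(* With H complete, this makes (H, ip) a Hilbert space. *)
Definition norm_of_inner : Prop := forall x : H, `|x| ^+ 2 = ip x x.

Lemma norm_inner_le x y : norm_of_inner -> `|ip x y| <= `|x| * `|y|.
Proof.
move=> ipE; have [->|y0] := eqVneq y 0; first by rewrite linear0r !normr0 mulr0.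
have d0 : 0 < ip y y by exact: neq0_dnorm_gt0.
rewrite -(@ler_pXn2r _ 2)// ?nnegrE ?mulr_ge0// exprMn !ipE.
set z := x - (ip x y / ip y y) *: y.
have oz : ip z y = 0 by rewrite linearBl/= linearZl_LR divfK ?subrr ?gt_eqF.
have -> : x = z + (ip x y / ip y y) *: y by rewrite subrK.
move: (ip x y / ip y y) => c.
rewrite linearDl/= linearZl_LR oz add0r normrM (ger0_norm (ltW d0)) exprMn.
rewrite hnormDd/=; last by rewrite linearZr_LR/= oz mulr0.
by rewrite dnormZ mulrDl [ip y y ^+ 2]expr2 mulrA lerDr mulr_ge0 ?(ltW d0)//.
Qed.

Lemma inner_continuous x : norm_of_inner -> continuous (ip x : H -> R[i]^o).
Proof.
move=> ipE y; apply/cvgrPdist_lt => e e0.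
near=> z; rewrite -linearBr.
apply: (le_lt_trans (norm_inner_le _ _ ipE)).
apply: (@le_lt_trans _ _ ((`|x| + 1) * `|y - z|)).
  by rewrite ler_wpM2r// lerDl.
rewrite -ltr_pdivlMl ?ltr_wpDl//.
by near: z; apply: cvgr_dist_lt => //; rewrite mulr_gt0 ?invr_gt0 ?ltr_wpDl.
Unshelve. all: by end_near. Qed.

End HilbertInner.

Section GelfandTriple.
Variables (R : realType) (V H : normedModType R[i]).

(* V is continuously and densely embedded in H by i; the second embedding
   of V, H, V^* is the transpose y |-> (y, i .), see embed_dual. *)
Record gelfand_triple (i : {linear V -> H}) : Prop := {
  gelfand_inj : injective i;
  gelfand_continuous : continuous i;
  gelfand_dense : dense (range i) }.

Definition compact_map (f : V -> H) : Prop :=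
  forall B : set V, bounded_set B -> precompact (f @` B).

Variable ip : {dot H for Num.conj}.
Hypothesis ipE : norm_of_inner ip.
Variable i : {linear V -> H}.
Hypothesis iG : gelfand_triple i.

Lemma embed_dual_subproof (y : H) : (fun v => ip y (i v)) \in @cdual_pred R V.
Proof.
apply/asboolP; split => [k u v|v]; first by rewrite linearP linearPr.
by apply: continuous_comp;
  [exact: gelfand_continuous|exact: inner_continuous].
Qed.

Definition embed_dual (y : H) : cdual V := CDual (embed_dual_subproof y).

Definition opI (u : V) : cdual V := embed_dual (i u).

Variable a : {hermitian_sym V for Num.conj}.
Hypothesis ac : continuous (fun p : V * V => a p.1 p.2 : R[i]^o).

Lemma opA_subproof (u : V) : (a u : V -> R[i]^o) \in @cdual_pred R V.
Proof.
apply/asboolP; split => [k v w|v]; first by rewrite linearPr.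
have pc : (fun w : V => (u, w)) @ v --> (u, v).
  by apply: cvg_pair; [exact: cvg_cst|exact: cvg_id].
have acu := cvg_comp _ _ pc (@ac (u, v)); exact acu.
Qed.

Definition opA (u : V) : cdual V := CDual (opA_subproof u).

Variable beta : R.

Definition opA_shift (u : V) : cdual V := opA u + beta%:C *: opI u.

Definition normalized (u : V) : V := `|i u|^-1 *: u.

Definition rayleigh (u : V) : R[i] := opA_shift u u / opI u u.

Definition inverse_iteration (u : nat -> V) : Prop :=
  forall j, opA_shift (u j.+1) = rayleigh (u j) *: opI (normalized (u j)).

End GelfandTriple.

(* Main.v *)
Require Import Defs.
From HB Require Import structures.
From mathcomp Require Import all_boot all_order all_algebra.
From mathcomp Require Import sesquilinear complex.
From mathcomp Require Import all_classical all_reals all_analysis.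

(* Write b = a + beta (.,.), |.| for the norm of H, t = u / |u| for the
   normalized iterate, mu for its Rayleigh quotient, and w for the next iterate,
   so that b(w,.) = mu (t,.).
   Since b(t,t) = b(w,t) = mu, we get 0 <= b(w-t,w-t) = b(w,w) - mu, while
   b(w,w) = mu (t,w) <= mu |w|. Hence |w| >= 1 and the Rayleigh quotient of w
   is at most mu / |w| <= mu: the quotients decrease to a limit, and their
   decrements control b(w-t,w-t), so that w - t -> 0 in V by coercivity.
   The t are bounded in V, hence converge in H along a subsequence; coercivity
   applied to b(w_j - w_k,.) = (mu_j t_j - mu_k t_k,.) makes the next iterates w
   a Cauchy sequence in V along it. Their limit is also that of the t, so it has
   H-norm 1, and it solves the limit equation. *)

Set Implicit Arguments.
Unset Strict Implicit.
Unset Printing Implicit Defensive.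

Import Order.TTheory GRing.Theory Num.Theory.
Import numFieldNormedType.Exports.

Local Open Scope classical_set_scope.
Local Open Scope ring_scope.
Local Open Scope complex_scope.

(** * Sequences, subsequences and limits over complex scalars *)

Lemma homo_cvg_infty (n : nat -> nat) :
  {homo n : j k / (j < k)%N} -> n k @[k --> \oo] --> \oo.
Proof.
move=> n_homo.
have n_ge k : (k <= n k)%N.
  by elim: k => // k IH; apply: leq_ltn_trans IH _; exact: n_homo.
move=> A [N _ NA]; exists N => // k /= Nk; apply: NA => /=.
exact: leq_trans (n_ge k).
Qed.

Section ComplexNormed.
Variables (R : realType) (V : normedModType R[i]).

Lemma cvg_real_complex (x : nat -> R) (l : R) :
  x @ \oo --> l -> ((x k)%:C : R[i]^o) @[k --> \oo] --> (l%:C : R[i]^o).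
Proof.
move=> xl; apply/cvgrPdist_lt => e e0.
(* A positive element of [R[i]] is real, so the tolerance [e] can be compared in [R]. *)
have eE : e = (complex.Re e)%:C by rewrite RRe_real ?gtr0_real.
move: e0; rewrite eE ltcR => e0.
near=> k; rewrite -raddfB/= normc_def/= expr0n/= addr0 sqrtr_sqr ltcR.
by near: k; exact: cvgr_dist_lt.
Unshelve. all: by end_near. Qed.

Lemma nonincreasing_cvg_complex (x : nat -> R[i]) :
  (forall j, 0 <= x j.+1 <= x j) ->
  exists l : R, (x k : R[i]^o) @[k --> \oo] --> (l%:C : R[i]^o).
Proof.
(* Nonnegativity in [R[i]] includes being real; the hypothesis gives it from index 1 on, hence the
   shift. *)
move=> x_noninc; pose y k := complex.Re (x k.+1).
have xE k : x k.+1 = (y k)%:C.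
  by rewrite RRe_real// ger0_real//; case/andP: (x_noninc k).
have y_noninc k : 0 <= y k.+1 <= y k.
  by rewrite -!lecR -!xE; exact: x_noninc.
have y_homo : nonincreasing_seq y.
  by apply/nonincreasing_seqP => k; case/andP: (y_noninc k).
have y_lb : has_lbound (range y).
  by exists 0 => _ [k _ <-]; rewrite -lecR -xE; case/andP: (x_noninc k).
exists (inf (range y)); rewrite -(@cvg_shiftS R[i]^o).
under eq_fun do rewrite xE.
exact: cvg_real_complex (nonincreasing_cvgn y_homo y_lb).
Qed.

Lemma cvg0_normX2 (x : nat -> V) :
  (`|x k| ^+ 2 : R[i]^o) @[k --> \oo] --> (0 : R[i]^o) -> x @ \oo --> (0 : V).
Proof.
move=> x0; apply/cvgr0Pnorm_lt => e e0.
near=> k; suff : `| `|x k| ^+ 2 : R[i]^o| < e ^+ 2.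
by rewrite ger0_norm ?exprn_ge0// ltr_pXn2r// ?nnegrE// ltW.
by near: k; apply: cvgr0_norm_lt => //; rewrite exprn_gt0.
Unshelve. all: by end_near. Qed.

Lemma compact_subsequence (K : set V) (x : nat -> V) :
  compact K -> (forall k, K (x k)) ->
  exists n : nat -> nat, {homo n : j k / (j < k)%N} /\
    exists h : V, x (n k) @[k --> \oo] --> h.
Proof.
move=> Kc Kx; have [h [_ h_cluster]] : K `&` cluster (x @ \oo) !=set0.
  by apply: Kc; exists 0%N => // k _; exact: Kx.
pose r k : R[i] := (k.+1%:R^-1 : R)%:C.
have r0 k : 0 < r k by rewrite ltcR invr_gt0.
(* A state is a pair (rank, index): the rank shrinks the radius [r] at each choice, while the index
   must grow. *)
have next (p : nat * nat) : {q : nat * nat |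
    [/\ q.1 = p.1.+1, (p.2 < q.2)%N & `|h - x q.2| < r q.1]}.
  apply: cid; have [|_ [[m pm <-]]] :=
    h_cluster (x @` [set m | (p.2 < m)%N]) _ _ (nbhsx_ballx h _ (r0 p.1.+1)).
    by exists p.2.+1 => // m /= pm; exists m.
  by rewrite -ball_normE => hm; exists (p.1.+1, m).
have [f [f0 fS]] := @dependent_choice _ _ next (0, 0)%N.
have f1 k : (f k).1 = k.
  by elim: k => [|k IH]; rewrite ?f0//; have [-> _ _] := fS k; rewrite IH.
(* The seed [f 0] carries no distance bound, so the subsequence starts at [f 1]. *)
exists (fun k => (f k.+1).2); split.
  by apply: homo_ltn => [|k]; [exact: ltn_trans|have [] := fS k.+1].
exists h; apply/cvgrPdist_lt => e e0.
have eE : e = (complex.Re e)%:C by rewrite RRe_real ?gtr0_real.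
have e0' : 0 < complex.Re e by rewrite -ltcR -eE.
near=> k; have [_ _ /lt_trans] := fS k; apply.
rewrite f1 eE ltcR (@le_lt_trans _ _ k.+1%:R^-1)//.
  by rewrite lef_pV2 ?posrE// ler_nat.
by near: k; exact: near_infty_natSinv_lt (PosNum e0').
Unshelve. all: by end_near. Qed.

End ComplexNormed.

(** A convergent [y] is Cauchy, the domination passes this on to [x], and completeness of [V] gives
    the limit. *)
Lemma cvg_dominated_increments (K : numFieldType) (V : completeNormedModType K)
    (W : normedModType K) (C : K) (x : nat -> V) (y : nat -> W) (l : W) :
  0 < C -> (forall j k, `|x j - x k| <= C * `|y j - y k|) ->
  y @ \oo --> l -> exists h : V, x @ \oo --> h.
Proof.
move=> C0 xy yl; apply/cvg_ex/cauchy_cvgP/cauchy_ballP => e e0.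
have eC : 0 < e / C / 2 by rewrite !divr_gt0.
have [N _ yN] : \forall k \near \oo, `|l - y k| < e / C / 2.
  exact: cvgr_dist_lt.
exists (x @` [set k | (N <= k)%N], x @` [set k | (N <= k)%N]).
  by split; exists N => // k /= Nk; exists k.
case=> _ _ [[j /= Nj <-] [k /= Nk <-]].
rewrite -ball_normE/= (le_lt_trans (xy _ _))// mulrC -ltr_pdivlMr//.
rewrite (splitr (e / C)) (le_lt_trans (ler_distD l _ _))//.
by rewrite ltrD ?yN// distrC yN.
Qed.

Lemma continuous_linear_bound (K : numFieldType) (V W : normedModType K)
    (f : {linear V -> W}) :
  continuous f -> exists2 C : K, 0 < C & forall v, `|f v| <= C * `|v|.
Proof.
move=> fc; have /linear_boundedP/pinfty_ex_gt0[C C0 fC] :=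
  continuous_linear_bounded 0 (fc 0).
by exists C.
Qed.

(** * The shifted form and its Rayleigh quotient *)

Section InverseIteration.
Variables (R : realType) (V H : completeNormedModType R[i]).
Variables (ip : {dot H for Num.conj}) (ipE : norm_of_inner ip).
Variables (i : {linear V -> H}) (iG : gelfand_triple i).
Variable a : {hermitian_sym V for Num.conj}.
Hypothesis ac : continuous (fun p : V * V => a p.1 p.2 : R[i]^o).
Variables (alpha beta : R).
Hypothesis alpha_gt0 : 0 < alpha.
Hypothesis garding : forall v : V,
  alpha%:C * `|v| ^+ 2 - beta%:C * `|i v| ^+ 2 <= a v v.

Local Notation b := (opA_shift ipE iG ac beta).
Local Notation mu := (rayleigh ipE iG ac beta).

Lemma opA_shiftE v w : b v w = a v w + beta%:C * ip (i v) (i w).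
Proof. by []. Qed.

Lemma opA_shift_conj v w : b v w = Num.conj (b w v).
Proof.
have beta_real : Num.conj beta%:C = beta%:C.
  by rewrite conj_Creal ?complex_real.
rewrite !opA_shiftE rmorphD rmorphM/= beta_real.
by rewrite (hermC a v w) (hermC ip (i v) (i w)) expr0 !mul1r.
Qed.

Lemma opA_shiftBl v w z : b (v - w) z = b v z - b w z.
Proof.
by rewrite !opA_shiftE linearBl raddfB linearBl/= mulrBr opprD addrACA.
Qed.

Lemma opA_shiftBr v w z : b v (w - z) = b v w - b v z.
Proof.
by rewrite !opA_shiftE linearBr raddfB linearBr/= mulrBr opprD addrACA.
Qed.

Lemma opA_shiftZ k v : b (k *: v) (k *: v) = `|k| ^+ 2 * b v v.
Proof.
have aZ : a (k *: v) (k *: v) = `|k| ^+ 2 * a v v.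
  by rewrite linearZl_LR linearZr_LR normCK -mulrA.
by rewrite !opA_shiftE aZ [i _]linearZ/= dnormZ mulrDr mulrCA.
Qed.

Lemma opA_shift_coercive v : alpha%:C * `|v| ^+ 2 <= b v v.
Proof. by rewrite opA_shiftE -ipE -lerBlDr garding. Qed.

Lemma opA_shift_ge0 v : 0 <= b v v.
Proof.
apply: le_trans (opA_shift_coercive v).
by rewrite mulr_ge0 ?exprn_ge0// lecR ltW.
Qed.

Lemma rayleighE v : mu v = b v v / `|i v| ^+ 2.
Proof. by rewrite ipE. Qed.

Lemma embed_gt0 v : v != 0 -> 0 < `|i v|.
Proof.
by move=> v0; rewrite normr_gt0 -(linear0 i) (inj_eq (gelfand_inj iG)).
Qed.

Lemma rayleigh_gt0 v : v != 0 -> 0 < mu v.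
Proof.
move=> v0; rewrite rayleighE divr_gt0 ?exprn_gt0 ?embed_gt0//.
apply: lt_le_trans (opA_shift_coercive v).
by rewrite mulr_gt0 ?exprn_gt0 ?normr_gt0// ltcR.
Qed.

Lemma norm_embed_normalized v : v != 0 -> `|i (normalized i v)| = 1.
Proof.
move=> v0; rewrite linearZ/= normrZ normfV normr_id mulVf//.
by rewrite gt_eqF ?embed_gt0.
Qed.

Lemma opA_shift_normalized v :
  b (normalized i v) (normalized i v) = mu v.
Proof. by rewrite opA_shiftZ rayleighE normfV normr_id exprVn mulrC. Qed.

(** * One step of the iteration *)

Section Step.
Variables u w : V.
Hypothesis u_neq0 : u != 0.
Hypothesis w_def : b w = mu u *: opI ipE iG (normalized i u).

Lemma stepE v : b w v = mu u * ip (i (normalized i u)) (i v).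
Proof. by rewrite w_def. Qed.

Lemma step_cross : b w (normalized i u) = mu u.
Proof. by rewrite stepE -ipE norm_embed_normalized// expr1n mulr1. Qed.

Lemma step_dist :
  b (w - normalized i u) (w - normalized i u) = b w w - mu u.
Proof.
rewrite opA_shiftBl !opA_shiftBr opA_shift_normalized step_cross.
(* The other cross term is the conjugate of [mu u], which is real because it is positive. *)
rewrite (opA_shift_conj (normalized i u) w) step_cross.
by rewrite conj_Creal ?gtr0_real ?rayleigh_gt0// subrr subr0.
Qed.

Lemma step_le_energy : mu u <= b w w.
Proof. by rewrite -subr_ge0 -step_dist opA_shift_ge0. Qed.

(** Test the step equation with [w] and apply Cauchy-Schwarz in [H], where the normalized [u] has
    norm 1. *)
Lemma step_energy_le : b w w <= mu u * `|i w|.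
Proof.
have mu0 := ltW (rayleigh_gt0 u_neq0).
rewrite -[b w w]ger0_norm ?opA_shift_ge0// stepE normrM ger0_norm//.
rewrite ler_wpM2l// -[leRHS]mul1r -(norm_embed_normalized u_neq0).
exact: norm_inner_le.
Qed.

Lemma step_embed_ge1 : 1 <= `|i w|.
Proof.
rewrite -(ler_pM2l (rayleigh_gt0 u_neq0)) mulr1.
exact: le_trans step_le_energy step_energy_le.
Qed.

(** This lets the step be repeated: the next normalization does not divide by zero. *)
Lemma step_neq0 : w != 0.
Proof.
apply/eqP => w0; have := step_embed_ge1.
by rewrite w0 linear0 normr0 ler10.
Qed.

Lemma step_rayleigh_norm : mu w * `|i w| <= mu u.
Proof.
have w0 := embed_gt0 step_neq0.
rewrite rayleighE -(ler_pM2r w0) -mulrA -expr2 divfK ?step_energy_le//.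
by rewrite gt_eqF ?exprn_gt0.
Qed.

Lemma step_rayleigh_le : mu w <= mu u.
Proof.
apply: le_trans step_rayleigh_norm.
by rewrite ler_peMr ?step_embed_ge1// ltW// rayleigh_gt0// step_neq0.
Qed.

(** Coercivity and [step_energy_le] bound the factor after [mu w] by [mu u * (|i w| - 1)].
    Multiplied by [mu w], the bracket becomes [mu w * |i w| - mu w], at most [mu u - mu w] by
    [step_rayleigh_norm]. *)
Lemma step_decrement :
  mu w * (alpha%:C * `|w - normalized i u| ^+ 2) <= mu u * (mu u - mu w).
Proof.
have mw := ltW (rayleigh_gt0 step_neq0).
have mu0 := ltW (rayleigh_gt0 u_neq0).
rewrite (le_trans (ler_wpM2l mw (opA_shift_coercive _)))// step_dist.
have /(ler_wpM2l mw)/le_trans -> // : b w w - mu u <= mu u * (`|i w| - 1).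
  by rewrite mulrBr mulr1 lerB ?step_energy_le.
by rewrite mulrCA ler_wpM2l// mulrBr mulr1 lerB ?step_rayleigh_norm.
Qed.

End Step.

(** Serves to replace the factor [mu w] in [step_decrement] by a constant. Coercivity and
    [|i v| <= C * |v|] give [alpha / C ^+ 2]. *)
Lemma rayleigh_lbound : exists2 m, 0 < m & forall v, v != 0 -> m <= mu v.
Proof.
have [C C0 iC] := continuous_linear_bound (gelfand_continuous iG).
exists (alpha%:C / C ^+ 2) => [|v v0].
  by rewrite divr_gt0 ?exprn_gt0// ltcR.
rewrite rayleighE ler_pdivlMr ?exprn_gt0 ?embed_gt0//.
apply: le_trans (opA_shift_coercive v).
have a0 : 0 <= alpha%:C by rewrite lecR ltW.
rewrite -mulrA ler_wpM2l//.
rewrite mulrC ler_pdivrMr ?exprn_gt0// -exprMn mulrC.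
by rewrite ler_pXn2r ?nnegrE ?mulr_ge0 ?(ltW C0).
Qed.

(** * Limits along the iteration *)

Hypothesis i_compact : compact_map i.
Variable u : nat -> V.
Hypothesis u0_neq0 : u 0%N != 0.
Hypothesis u_iter : inverse_iteration ipE iG ac beta u.

Lemma iterate_neq0 j : u j != 0.
Proof. by elim: j => // j uj; exact: (step_neq0 uj (u_iter j)). Qed.

Lemma rayleigh_iterate_le j : 0 <= mu (u j.+1) <= mu (u j).
Proof.
rewrite ltW ?rayleigh_gt0 ?iterate_neq0//=.
exact: (step_rayleigh_le (iterate_neq0 j) (u_iter j)).
Qed.

Lemma rayleigh_iterate_le0 j : mu (u j) <= mu (u 0%N).
Proof.
elim: j => // j; apply: le_trans.
by case/andP: (rayleigh_iterate_le j).
Qed.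

Lemma iterate_increment_cvg0 :
  (u j.+1 - normalized i (u j)) @[j --> \oo] --> (0 : V).
Proof.
have [m m0 mu_ge] := rayleigh_lbound.
have [l mu_l] := nonincreasing_cvg_complex rayleigh_iterate_le.
have mua : 0 < m * alpha%:C by rewrite mulr_gt0// ltcR.
(* [K] collects the constants of [step_decrement], with [mu] at most its initial value on the right
   and at least [m] on the left. *)
pose K := mu (u 0%N) / (m * alpha%:C).
have dmu : (K *: (mu (u k) - mu (u k.+1)) : R[i]^o) @[k --> \oo]
    --> (0 : R[i]^o).
  rewrite -[X in _ --> X](scaler0 _ K) -[X in K *: X](subrr l%:C).
  apply: cvgZr; apply: (@cvgB _ R[i]^o) => //.
  by rewrite (@cvg_shiftS R[i]^o (fun k => mu (u k))).
apply: cvg0_normX2; apply/cvgr0Pnorm_lt => e e0.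
near=> k.
have -> : `| `|u k.+1 - normalized i (u k)| ^+ 2 : R[i]^o| =
    `|u k.+1 - normalized i (u k)| ^+ 2 by rewrite ger0_norm ?exprn_ge0.
apply: (@le_lt_trans _ _ `|(K *: (mu (u k) - mu (u k.+1)) : R[i]^o)|);
  last first.
  by near: k; exact: cvgr0_norm_lt.
have /andP[mk0 mk] := rayleigh_iterate_le k.
rewrite -subr_ge0 in mk.
rewrite ger0_norm; last first.
  rewrite mulr_ge0// divr_ge0// 1?ltW//.
  by rewrite rayleigh_gt0.
rewrite /GRing.scale/= /K mulrAC ler_pdivlMr// mulrC -mulrA.
apply: le_trans (ler_wpM2r mk (rayleigh_iterate_le0 k)).
apply: le_trans (step_decrement (iterate_neq0 k) (u_iter k)).
by rewrite ler_wpM2r ?mu_ge ?iterate_neq0// mulr_ge0 ?exprn_ge0// lecR ltW.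
Unshelve. all: by end_near. Qed.

Lemma normalized_subsequence : exists n : nat -> nat,
  {homo n : j k / (j < k)%N} /\
  exists h : H, i (normalized i (u (n k))) @[k --> \oo] --> h.
Proof.
pose B := range (fun k => normalized i (u k)).
have B_bounded : bounded_set B.
  have M0 : 0 <= mu (u 0%N) / alpha%:C.
    by rewrite divr_ge0 ?lecR ?ltW// rayleigh_gt0.
  (* Coercivity at a normalized iterate [t] reads [alpha * |t| ^+ 2 <= mu], and [mu] never exceeds
     its initial value. *)
  exists (sqrtC (mu (u 0%N) / alpha%:C)); split.
    by rewrite ger0_real// sqrtC_ge0.
  move=> M /ltW/(le_trans _) ltM _ [k _ <-] /=; apply: ltM.
  rewrite -(@ler_pXn2r _ 2)// ?nnegrE// ?sqrtC_ge0// sqrtCK.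
  rewrite ler_pdivlMr ?ltcR// mulrC.
  apply: le_trans (rayleigh_iterate_le0 k).
  by rewrite -(opA_shift_normalized (u k)) opA_shift_coercive.
have := i_compact B_bounded; rewrite precompactE => cB.
apply: (@compact_subsequence _ _ _ (i \o normalized i \o u) cB) => k.
apply: subset_closure.
by exists (normalized i (u k)) => //; exists k.
Qed.

(** Subtract two step equations and test with the difference [d] itself: [alpha * |d| ^+ 2 <= ip g
    (i d) <= C * |g| * |d|], with [g] the difference of the right-hand sides. Dividing by [|d|] sets
    the case [d = 0] apart. *)
Lemma iterate_dist : exists2 C : R[i], 0 < C &
  forall j k, `|u j.+1 - u k.+1| <=
    C * `|mu (u j) *: i (normalized i (u j)) -
          mu (u k) *: i (normalized i (u k))|.
Proof.
have [C C0 iC] := continuous_linear_bound (gelfand_continuous iG).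
have a0 : 0 < alpha%:C by rewrite ltcR.
exists (C / alpha%:C) => [|j k]; first by rewrite divr_gt0.
have [->|] := eqVneq (u j.+1) (u k.+1).
  by rewrite subrr normr0 mulr_ge0// divr_ge0// ltW.
rewrite -subr_eq0; set d := _ - u k.+1 => d0.
set g := _ - _ *: _.
have bd : b d d = ip g (i d).
  rewrite /d opA_shiftBl (stepE (u_iter j)) (stepE (u_iter k)) /g linearBl/=.
  by rewrite !linearZl_LR.
rewrite mulrAC ler_pdivlMr// -(@ler_pM2r _ `|d|) ?normr_gt0//.
rewrite [`|d| * _]mulrC -mulrA -expr2 (le_trans (opA_shift_coercive d))//.
rewrite -[b d d]ger0_norm ?opA_shift_ge0// bd.
apply: le_trans (norm_inner_le _ _ ipE) _.
by rewrite mulrAC [C * _ * _]mulrC ler_wpM2l.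
Qed.

Lemma inner_cvgl (x : nat -> H) (l y : H) :
  x @ \oo --> l -> (ip (x k) y : R[i]^o) @[k --> \oo] --> (ip l y : R[i]^o).
Proof.
move=> xl; apply/cvgrPdist_lt => e e0; near=> k; rewrite -linearBl.
apply: (le_lt_trans (norm_inner_le _ _ ipE)).
(* Adding 1 keeps the divisor positive when [y = 0]. *)
apply: (@le_lt_trans _ _ (`|l - x k| * (`|y| + 1))).
  by rewrite ler_wpM2l// lerDl.
rewrite -ltr_pdivlMr ?ltr_wpDl//.
by near: k; apply: cvgr_dist_lt => //; rewrite divr_gt0 ?ltr_wpDl.
Unshelve. all: by end_near. Qed.

Lemma opA_shift_cvg (x : nat -> V) (l v : V) :
  x @ \oo --> l -> (b (x k) v : R[i]^o) @[k --> \oo] --> (b l v : R[i]^o).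
Proof.
move=> xl; apply: (@cvgD _ R[i]^o).
  have xv : (fun k => (x k, v)) @ \oo --> (l, v).
    by apply: cvg_pair; [exact: xl|exact: cvg_cst].
  have axv := cvg_comp _ _ xv (@ac (l, v)); exact: axv.
apply: cvgZr; apply: inner_cvgl.
exact: (cvg_comp _ _ xl (@gelfand_continuous _ _ _ _ iG l)).
Qed.

Lemma inverse_iteration_cvg : exists (ustar : V) (lstar : R),
  [/\ ustar != 0,
      opA ac ustar = lstar%:C *: opI ipE iG ustar &
      exists n : nat -> nat,
        [/\ {homo n : j k / (j < k)%N},
            u (n k) @[k --> \oo] --> ustar &
            (mu (u (n k)) - beta%:C : R[i]^o)
              @[k --> \oo] --> (lstar%:C : R[i]^o)]].
Proof.
have [n [n_homo [h uh]]] := normalized_subsequence.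
have n_oo := homo_cvg_infty n_homo.
have [l mu_l] := nonincreasing_cvg_complex rayleigh_iterate_le.
have mu_n : (mu (u (n k)) : R[i]^o) @[k --> \oo] --> (l%:C : R[i]^o).
  exact: cvg_comp n_oo mu_l.
have [C C0 uC] := iterate_dist.
have [ustar w_cvg] : exists ustar : V, u (n k).+1 @[k --> \oo] --> ustar.
  pose y k := mu (u k) *: i (normalized i (u k)).
  apply: (@cvg_dominated_increments _ V H C (u \o S \o n) (y \o n) (l%:C *: h))
    => // [j k|]; first exact: uC.
  exact: cvgZ mu_n uh.
have t_cvg : normalized i (u (n k)) @[k --> \oo] --> ustar.
  under eq_fun => k do rewrite -[normalized i _](subKr (u (n k).+1)).
  rewrite -(subr0 ustar); apply: cvgB => //.
  exact: (cvg_comp _ _ n_oo iterate_increment_cvg0).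
have it_cvg : i (normalized i (u (n k))) @[k --> \oo] --> i ustar.
  exact: (cvg_comp _ _ t_cvg (@gelfand_continuous _ _ _ _ iG ustar)).
(* The limit equation for the shifted form has eigenvalue [l]; undoing the shift gives
   [l - beta]. *)
exists ustar, (l - beta); split.
(* If [ustar] were 0, the normalized iterates would tend to 0 in [H], although their norm there is
   1. *)
- apply/eqP => ustar0; move: it_cvg; rewrite ustar0 linear0.
  move=> /cvgr0_norm_lt/(_ 1 ltr01)[N _ /(_ N (leqnn N))] /=.
  by rewrite norm_embed_normalized ?iterate_neq0// ltxx.
- apply/val_inj/funext => v.
  have b_eq : b ustar v = l%:C * ip (i ustar) (i v).
    (* The limits of [b (u (n k).+1) v] found by continuity and by the step equation must agree. *)
    have b1 := opA_shift_cvg (v := v) w_cvg.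
    have b2 : (b (u (n k).+1) v : R[i]^o) @[k --> \oo]
        --> (l%:C * ip (i ustar) (i v) : R[i]^o).
      under eq_fun do rewrite (stepE (u_iter _)).
      by apply: (@cvgZ _ R[i]^o); [exact: mu_n|exact: inner_cvgl].
    exact: (cvg_unique (@norm_hausdorff _ R[i]^o) b1 b2).
  have aE : a ustar v = (l - beta)%:C * ip (i ustar) (i v).
    by rewrite raddfB/= mulrBl -b_eq opA_shiftE addrK.
  exact: aE.
(* Convergence in [V] was obtained for the successors [u (n k).+1], hence the shift by one; [mu]
   keeps its limit. *)
- exists (fun k => (n k).+1); split => [j k jk| |].
  + by rewrite ltnS n_homo.
  + exact: w_cvg.
  + have mu_S : (mu (u k.+1) : R[i]^o) @[k --> \oo] --> (l%:C : R[i]^o).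
      by rewrite (@cvg_shiftS R[i]^o (fun k => mu (u k))).
    have mu_nS := cvg_comp _ _ n_oo mu_S.
    rewrite raddfB; apply: (@cvgB _ R[i]^o _ _ _ _ (cst beta%:C) _ _ mu_nS).
    exact: (@cvg_cst R[i]^o).
Qed.

End InverseIteration.

Theorem theorem3p1 (R : realType) (V H : completeNormedModType R[i])
  (ip : {dot H for Num.conj}) (ipE : norm_of_inner ip)
  (V_separable : separable V) (V_reflexive : reflexive_space V)
  (H_separable : separable H)
  (i : {linear V -> H}) (iG : gelfand_triple i) (i_compact : compact_map i)
  (a : {hermitian_sym V for Num.conj})
  (ac : continuous (fun p : V * V => a p.1 p.2 : R[i]^o))
  (alpha beta : R) (alpha_gt0 : 0 < alpha) (beta_ge0 : 0 <= beta)
  (garding : forall v : V,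
     alpha%:C * `|v| ^+ 2 - beta%:C * `|i v| ^+ 2 <= a v v)
  (u : nat -> V) (u0_neq0 : u 0%N != 0)
  (u_iter : inverse_iteration ipE iG ac beta u) :
  exists (ustar : V) (lstar : R),
    [/\ ustar != 0,
        opA ac ustar = lstar%:C *: opI ipE iG ustar &
        exists n : nat -> nat,
          [/\ {homo n : j k / (j < k)%N},
              u (n k) @[k --> \oo] --> ustar &
              (rayleigh ipE iG ac beta (u (n k)) - beta%:C : R[i]^o)
                @[k --> \oo] --> (lstar%:C : R[i]^o)]].
Proof. exact: (inverse_iteration_cvg alpha_gt0). Qed.
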